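(* Let $d, r, n$ be positive integers and let $\mathcal{T}_d$ be the class of graphs of tree-depth at most $d$. Then $f_{\mathcal{T}_d^r}(n)<\infty$, where $\mathcal{T}_d^r=\{G^r : G\in\mathcal{T}_d\}$.
   Context: All graphs are finite, simple and undirected. The $r$-power $G^r$ of a graph $G$ is the graph on $V(G)$ in which two distinct vertices are adjacent iff their distance in $G$ is at most $r$. A rooted forest is a forest with a specified root in each component; $v$ is an ancestor of $u$ if $v$ lies on the path from $u$ to the root. The closure of a rooted forest $T$ is the graph obtained from $T$ by joining each vertex to all its ancestors. The height of a rooted forest is the number of vertices of a longest root-to-leaf path. The tree-depth of $G$ is the minimum height of a rooted forest whose closure contains $G$ as a subgraph. Given a family $\mathcal{I}$ of independent sets in a graph, a rainbow independent set is an independent set $I$ for which there is an injection $\phi\colon I\to\mathcal{I}$ with $v\in\phi(v)$ for every $v\in I$. For a graph $H$ and positive integer $n$, $f_H(n)$ is the minimum $k$ such that every family of $k$ independent sets of size $n$ in $H$ contains a rainbow independent set of size $n$; for a class $\mathcal{C}$, $f_{\mathcal{C}}(n)=\sup\{f_H(n): H\in\mathcal{C}\}$. *)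

(* Defs.v *)
From HB Require Import structures.
From mathcomp Require Import all_boot all_order all_algebra.
From mathcomp Require Import boolp classical_sets reals ereal.

Set Implicit Arguments.
Unset Strict Implicit.
Unset Printing Implicit Defensive.

Import Order.TTheory GRing.Theory Num.Theory.

Record sgraph := SGraph {
  vertex :> finType;
  adj : rel vertex;
  adj_sym : symmetric adj;
  adj_irr : irreflexive adj }.
Arguments adj {s}.

Definition walk (G : sgraph) (k : nat) (x y : G) : bool :=
  [exists p : k.-tuple G, path adj x p && (last x p == y)].

(* False when [x] and [y] lie in different components. *)
Definition dist_le (G : sgraph) (r : nat) (x y : G) : bool :=
  [exists k : 'I_r.+1, walk k x y].

Definition power_adj (r : nat) (G : sgraph) : rel G :=
  [rel x y | (x != y) && dist_le r x y].

Lemma dist_le_sym (G : sgraph) r : symmetric (@dist_le G r).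
Proof.
have H (x y : G) : dist_le r x y -> dist_le r y x; last by move=> x y; apply/idP/idP; exact: H.
move=> /existsP[k] /existsP[p /andP[pp /eqP <-]].
have sz : size (rev (belast x p)) == k by rewrite size_rev size_belast size_tuple.
apply/existsP; exists k; apply/existsP; exists (Tuple sz) => /=.
rewrite rev_path (eq_path (e' := adj)) ?pp /=; last by move=> a b; rewrite adj_sym.
case: (tval p) => [|a q] //=.
by rewrite rev_cons last_rcons.
Qed.

Lemma power_adj_sym r (G : sgraph) : symmetric (@power_adj r G).
Proof. by move=> x y; rewrite /power_adj /= eq_sym dist_le_sym. Qed.

Lemma power_adj_irr r (G : sgraph) : irreflexive (@power_adj r G).
Proof. by move=> x; rewrite /power_adj /= eqxx. Qed.

Definition power (r : nat) (G : sgraph) : sgraph :=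
  SGraph (@power_adj_sym r G) (@power_adj_irr r G).

Definition acyclic (G : sgraph) : Prop :=
  forall c : seq G, 2 < size c -> ~ ucycle adj c.

Record rforest := RForest {
  forest :> sgraph;
  roots : {set forest};
  forest_acyclic : acyclic forest;
  forest_root : forall x : forest,
    exists! t, t \in roots /\ connect adj x t }.

(* [p] lists the vertices of a path after its first vertex [x]. *)
Definition simple_path (G : sgraph) (x : G) (p : seq G) : bool :=
  path adj x p && uniq (x :: p).

Definition ancestor (F : rforest) (v u : F) : Prop :=
  exists p : seq F,
    [/\ simple_path u p, last u p \in roots F & v \in u :: p].

(* A vertex without proper descendants; the root of a one-vertex component
   is thus a leaf, whereas a root of degree one is not. *)
Definition leaf (F : rforest) (v : F) : Prop :=
  forall u : F, ancestor v u -> u = v.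

Definition root_leaf_path (F : rforest) (x : F) (p : seq F) : Prop :=
  [/\ x \in roots F, simple_path x p & leaf (last x p)].

(* The bound #|F| on the number of vertices of a path is no restriction,
   since paths are duplicate-free. *)
Definition height (F : rforest) : nat :=
  \max_(k < #|F|.+1
    | `[< exists x (p : seq F), root_leaf_path x p /\ size (x :: p) = k >]) k.

Definition closure_adj (F : rforest) : rel F :=
  [rel x y | (x != y) && (adj x y || `[< ancestor x y \/ ancestor y x >])].

Lemma closure_adj_sym (F : rforest) : symmetric (@closure_adj F).
Proof.
move=> x y; rewrite /closure_adj /= eq_sym adj_sym; congr (_ && (_ || _)).
by apply: asbool_equiv_eq; rewrite or_comm.
Qed.

Lemma closure_adj_irr (F : rforest) : irreflexive (@closure_adj F).
Proof. by move=> x; rewrite /closure_adj /= eqxx. Qed.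

Definition closure_graph (F : rforest) : sgraph :=
  SGraph (@closure_adj_sym F) (@closure_adj_irr F).

Definition subgraph (G H : sgraph) : Prop :=
  exists f : G -> H, injective f /\ {homo f : x y / adj x y}.

Definition elimination_height (G : sgraph) (k : nat) : Prop :=
  exists F : rforest, subgraph G (closure_graph F) /\ height F = k.

Section PathForest.
Variable n : nat.

Definition pathg_adj : rel 'I_n := [rel i j : 'I_n | (i.+1 == j) || (j.+1 == i)].

Lemma pathg_adj_sym : symmetric pathg_adj.
Proof. by move=> i j; rewrite /pathg_adj /= orbC. Qed.

Lemma pathg_adj_irr : irreflexive pathg_adj.
Proof. by move=> i; rewrite /pathg_adj /= orbb; apply/negbTE; rewrite neq_ltn ltnSn orbT. Qed.

Definition pathg := SGraph pathg_adj_sym pathg_adj_irr.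

Lemma pathg_acyclic : acyclic pathg.
Proof.
move=> c szc /andP[cc uc].
have [x0 x0c] : exists x, x \in c by case: c szc {cc uc} => // a s _; exists a; rewrite mem_head.
pose m := [arg max_(i > x0 in c) (i : nat)].
have [mc mmax] : m \in c /\ forall j, j \in c -> j <= m.
  by rewrite /m; case: arg_maxnP.
have [k s rotE] := rot_to mc.
have mem_s j : j \in s -> j <= m.
  by move=> js; apply: mmax; rewrite -(mem_rot k) rotE in_cons js orbT.
move: szc cc uc; rewrite -(size_rot k) -(rot_cycle k) -(rot_uniq k) rotE.
case: s mem_s {rotE} => [|y s] // mem_s; case/lastP: s mem_s => [|s z] // mem_s _.
have hy : y <= m by apply: mem_s; rewrite mem_head.
have hz : z <= m by apply: mem_s; rewrite in_cons mem_rcons mem_head orbT.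
have step (a b : pathg) : adj a b -> b <= a -> b.+1 = a.
  by move=> /orP[/eqP<-|/eqP//]; rewrite ltnn.
rewrite /= rcons_path last_rcons => /andP[my /andP[_ zm]].
have e1 := step _ _ my hy.
have e2 : z.+1 = m by apply: step hz; rewrite adj_sym.
have yz : y = z by apply/val_inj/succn_inj; rewrite e1 e2.
by rewrite yz mem_rcons mem_head /= andbF.
Qed.

Definition pathg_roots : {set pathg} := [set i : 'I_n | i == 0 :> nat].

Lemma pathg_down (j : pathg) : exists p : seq pathg,
  [/\ simple_path j p, last j p \in pathg_roots,
      forall i : pathg, i <= j -> i \in j :: p &
      forall i : pathg, i \in j :: p -> i <= j].
Proof.
case: j => j; elim: j => [|j IH] lj.
  exists [::]; split=> //=; first by rewrite inE.
    by move=> i; rewrite leqn0 => /eqP i0; rewrite inE; apply/eqP/val_inj.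
  by move=> i; rewrite inE => /eqP->.
have [p [/andP[pp up] lp inp ple]] := IH (ltnW lj).
exists (Ordinal (ltnW lj) :: p); split=> //.
- rewrite /simple_path /= in pp up *; rewrite /pathg_adj /= pp eqxx orbT up !andbT /=.
  by apply/negP=> /ple; rewrite /= ltnn.
- move=> i; rewrite leq_eqVlt => /orP[/eqP ij|ij].
    by rewrite (_ : i = Ordinal lj) ?mem_head //; apply: val_inj.
  by rewrite in_cons inp ?orbT.
- by move=> i; rewrite in_cons => /orP[/eqP->//|/ple/leqW].
Qed.

Lemma pathg_root (x : pathg) : exists! t, t \in pathg_roots /\ connect adj x t.
Proof.
have [p [/andP[pp _] lp _ _]] := pathg_down x.
exists (last x p); split; first by split=> //; apply/connectP; exists p.
move=> t [tr _]; move: lp tr; rewrite !inE => /eqP a /eqP b.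
by apply: val_inj; rewrite /= a b.
Qed.

Definition path_forest := RForest pathg_acyclic pathg_root.

End PathForest.

Lemma elimination_height_ex (G : sgraph) :
  exists k, `[< elimination_height G k >].
Proof.
exists (height (path_forest #|G|)); apply/asboolP; exists (path_forest #|G|); split=> //.
exists (fun x : G => enum_rank x); split; first exact: enum_rank_inj.
move=> x y xy /=; apply/andP; split.
  by rewrite (inj_eq enum_rank_inj); apply: contraTneq xy => ->; rewrite adj_irr.
apply/orP; right; apply/asboolP.
have anc (i j : path_forest #|G|) : i <= j -> ancestor i j.
  by move=> ij; have [p [sp lp inp _]] := pathg_down j; exists p; split=> //; exact: inp.
by have [le|lt] := leqP (enum_rank x) (enum_rank y); [left|right]; apply: anc => //; exact: ltnW.
Qed.

Definition treedepth (G : sgraph) : nat := ex_minn (elimination_height_ex G).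

Definition independent (G : sgraph) (S : {set G}) : Prop :=
  {in S &, forall x y, ~~ adj x y}.

(* Families are indexed: repeated members are allowed, and a rainbow set
   picks distinct indices. *)
Definition rainbow_independent (G : sgraph) (k : nat) (I : 'I_k -> {set G})
    (S : {set G}) : Prop :=
  independent S /\
  exists phi : {v : G | v \in S} -> 'I_k,
    injective phi /\ forall v, val v \in I (phi v).

Definition forces_rainbow (G : sgraph) (n k : nat) : Prop :=
  forall I : 'I_k -> {set G},
    (forall i, independent (I i) /\ #|I i| = n) ->
    exists S : {set G}, rainbow_independent I S /\ #|S| = n.

Lemma forces_rainbow_ex (G : sgraph) (n : nat) :
  exists k, `[< forces_rainbow G n k >].
Proof.
exists (#|{set G}| * n).+1; apply/asboolP => I HI.
have [A nA] : exists A : {set G}, n <= #|[set i | I i == A]| /\ exists i, I i = A.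
  have [A lA] : exists A : {set G}, n < #|[set i | I i == A]|.
    apply/existsP; apply: contraT; rewrite negb_exists => /forallP H.
    have : \sum_(A : {set G}) #|[set i | I i == A]| <= \sum_(A : {set G}) n.
      by apply: leq_sum => A _; rewrite leqNgt.
    rewrite sum_nat_const.
    under eq_bigr do rewrite cardsE -sum1_card.
    rewrite (exchange_big_dep xpredT) //=.
    under eq_bigr => i _.
      rewrite (eq_bigl (pred1 (I i))); last by move=> A; rewrite unfold_in /= eq_sym.
      rewrite big_pred1_eq; over.
    by rewrite sum1_card card_ord ltnn.
  exists A; split; first exact: ltnW.
  have /card_gt0P[i] : 0 < #|[set i | I i == A]| by apply: leq_ltn_trans lA.
  by rewrite inE => /eqP; exists i.
case: nA => nA [i0 iA]; have [indA cA] := HI i0; rewrite iA in indA cA.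
exists A; split=> //; split=> //.
have le : #|{: {v : G | v \in A}}| <= #|[set i | I i == A]|.
  by rewrite card_sig (@eq_card _ _ (mem A)) ?cA.
exists (fun v => enum_val (widen_ord le (enum_rank v))); split.
  by move=> u v /enum_val_inj/(congr1 val)/= /val_inj/enum_rank_inj.
move=> v; set j := enum_val _.
have : j \in [set i | I i == A] by exact: enum_valP.
by rewrite inE => /eqP->; exact: valP.
Qed.

Definition rainbow_num (G : sgraph) (n : nat) : nat :=
  ex_minn (forces_rainbow_ex G n).

(* Graph classes are plain predicates: universe constraints rule out
   [set sgraph]. *)
Definition graph_class := sgraph -> Prop.

Definition treedepth_class (d : nat) : graph_class :=
  fun G => treedepth G <= d.

Definition power_class (r : nat) (C : graph_class) : graph_class :=
  fun H => exists2 G, C G & H = power r G.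

Local Open Scope classical_set_scope.

Definition rainbow_num_class (R : realType) (C : graph_class) (n : nat) :
    \bar R :=
  ereal_sup [set x | exists2 H, C H & x = ((rainbow_num H n)%:R)%:E].

(* Main.v *)
Require Import Defs.
From HB Require Import structures.
From mathcomp Require Import all_boot all_order all_algebra.
From mathcomp Require Import boolp classical_sets reals ereal.

Set Implicit Arguments.
Unset Strict Implicit.
Unset Printing Implicit Defensive.

(** In a graph [G] embedded in the closure of a rooted forest of height at most
    [d], every walk visits a common ancestor of all its vertices. Hence
    [dist x y <= r] holds iff for some depth [h] the vertices [x] and [y] have
    the same ancestor [w] at depth [h] and [dist x w + dist w y <= r]. Given
    many [r]-independent sets [v i 1, ..., v i n], colour a pair [i < j] by all
    data [(a, b, h, dist, dist)] witnessing that [v i a] and [v j b] are close,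
    and take a large homogeneous set of indices. If some datum occurs, then for
    [i < j < l] the vertices [v j a], [v l b], [v i a], [v j b] successively
    share their ancestor at depth [h], so [v j a] and [v j b] are close: a
    contradiction. So the diagonal choice [v (s a) a] is independent. *)

(** * Ramsey's theorem for pairs *)

(** Induction on the sum of the targets; separate targets let a step lower just one. The head [x]
    splits the tail by colour, some class is long enough for [m k] lowered by one, and [x] is
    prepended if colour [k] comes out. *)
Lemma ramsey_pairs_weighted (C : finType) (m : C -> nat) :
  exists K, forall (T : eqType) (c : T -> T -> C) (s : seq T), K <= size s ->
    exists k t, [/\ subseq t s, size t = m k & pairwise (fun x y => c x y == k) t].
Proof.
have [N] := ubnP (\sum_k m k); elim: N m => // N IH m; rewrite ltnS => leN.
have [[k0 mk0]|m_gt0] := pselect (exists k, m k = 0).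
  by exists 0 => T c s _; exists k0, [::]; split=> //; exact: sub0seq.
have dec k : exists K, forall (T : eqType) (c : T -> T -> C) (s : seq T), K <= size s ->
    exists k' t, [/\ subseq t s, size t = m k' - (k' == k) &
                     pairwise (fun x y => c x y == k') t].
  apply: (IH (fun k' => m k' - (k' == k))); apply: leq_trans leN.
  rewrite (bigD1 k) //= [X in _ < X](bigD1 k) //= eqxx.
  rewrite -addSn leq_add //.
    by rewrite subn1 ltn_predL lt0n; apply/eqP => mk; apply: m_gt0; exists k.
  by apply: leq_sum => k' _; exact: leq_subr.
have [K HK] := fin_all_exists dec.
(* The successor pays for the head [x]; the tail keeps [\sum_k K k] entries, so some class reaches
   its [K k]. *)
exists (\sum_k K k).+1 => T c [//|x s]; rewrite -[size _]/(size s).+1 ltnS => leK.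
have [k lek] : exists k, K k <= size [seq y <- s | c x y == k].
  apply: contrapT => noK; move: leK; rewrite leqNgt => /negP; apply.
  have lt k : size [seq y <- s | c x y == k] < K k.
    by rewrite ltnNge; apply/negP => le; apply: noK; exists k.
  have -> : size s = \sum_k size [seq y <- s | c x y == k].
    rewrite -[LHS]sum1_size; under [RHS]eq_bigr do rewrite size_filter -sum1_count.
    rewrite (exchange_big_dep xpredT) //=; apply: eq_bigr => y _.
    by under eq_bigl do rewrite eq_sym; rewrite big_pred1_eq.
  (* The colour [c x x] witnesses that [C] is inhabited, which strictness of the sum requires. *)
  rewrite (bigD1 (c x x)) //= [X in _ < X](bigD1 (c x x)) //= -addSn leq_add //.
  by apply: leq_sum => k _; exact: ltnW.
have [k' [t [sub_t sz_t pw_t]]] := HK k T c _ lek.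
have sub_ts : subseq t s by apply: subseq_trans sub_t _; exact: filter_subseq.
have [ekk|nek] := eqVneq k' k; last first.
  exists k', t; split=> //; last by rewrite sz_t (negbTE nek) subn0.
  by apply: subseq_trans sub_ts _; exact: subseq_cons.
exists k', (x :: t); split=> //=; first by rewrite eqxx.
  rewrite sz_t ekk eqxx subn1 prednK // lt0n; apply/eqP => mk.
  by apply: m_gt0; exists k.
rewrite pw_t andbT; apply/allP => y /(mem_subseq sub_t).
by rewrite mem_filter ekk => /andP[].
Qed.

Lemma ramsey_pairs (C : finType) (m : nat) :
  exists K, forall (T : eqType) (c : T -> T -> C) (s : seq T), K <= size s ->
    exists k t, [/\ subseq t s, size t = m & pairwise (fun x y => c x y == k) t].
Proof. exact: (@ramsey_pairs_weighted C (fun=> m)). Qed.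

(** * Hubs and rainbow independent sets in powers *)

Lemma dist_leP (G : sgraph) r (x y : G) :
  reflect (exists2 p, path adj x p /\ size p <= r & last x p = y) (dist_le r x y).
Proof.
apply: (iffP existsP) => [[k /existsP[p /andP[pp /eqP lp]]]|[p [pp sz] lp]].
  by exists p => //; split=> //; rewrite size_tuple -ltnS.
have lt : size p < r.+1 by [].
exists (Ordinal lt); apply/existsP; exists (in_tuple p).
by rewrite /= pp lp eqxx.
Qed.

Lemma dist_le_refl (G : sgraph) r (x : G) : dist_le r x x.
Proof. by apply/dist_leP; exists [::]. Qed.

Lemma dist_le_add (G : sgraph) p q r (x y z : G) :
  dist_le p x y -> dist_le q y z -> p + q <= r -> dist_le r x z.
Proof.
move=> /dist_leP[s [ps szs] ls] /dist_leP[t [pt szt] lt] le.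
apply/dist_leP; exists (s ++ t); last by rewrite last_cat ls.
rewrite cat_path ps ls pt size_cat; split=> //.
by apply: leq_trans le; exact: leq_add.
Qed.

(* [hub h x w] abstracts "[w] is the ancestor of [x] at depth [h]". *)
Definition hub_system (G : sgraph) (d r : nat) (hub : nat -> G -> G -> Prop) : Prop :=
  (forall h x w w', hub h x w -> hub h x w' -> w = w') /\
  (forall x y, dist_le r x y -> exists h p q w,
     [/\ h < d, p + q <= r, hub h x w /\ hub h y w, dist_le p x w & dist_le q w y]).

(** The colours depend on [d], [r] and [n] alone, so one [K] serves all graphs, as a supremum over a
    class demands. *)
Lemma hub_system_forces_rainbow (d r n : nat) :
  exists K, forall (G : sgraph) (hub : nat -> G -> G -> Prop),
    hub_system d r hub -> forces_rainbow (power r G) n K.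
Proof.
pose D := ('I_n * 'I_n * ('I_d * 'I_r.+1 * 'I_r.+1))%type.
(* A colour is the set of all data holding for a pair, so on a homogeneous list a datum holds for
   every pair or for none. Length [n.+3] provides the positions 0, 1, 2 as well as those below
   [n]. *)
have [K HK] := ramsey_pairs {set D} n.+3.
exists K => G hub [hub_fun hub_dist] I HI.
pose v (i : 'I_K) (a : 'I_n) : G := enum_val (cast_ord (esym (HI i).2) a).
have v_in i a : v i a \in I i by exact: enum_valP.
have v_inj i : injective (v i) by move=> a b /enum_val_inj/cast_ord_inj.
pose link (h p q : nat) (x y : G) :=
  exists w, [/\ hub h x w, hub h y w, dist_le p x w & dist_le q w y].
pose col i j : {set D} :=
  [set z : D | `[< link z.2.1.1 z.2.1.2 z.2.2 (v i z.1.1) (v j z.1.2) >]].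
have [|k [t [sub_t sz_t pw_t]]] := HK _ col (enum 'I_K).
  by rewrite size_enum_ord.
have uniq_t : uniq t by apply: subseq_uniq sub_t _; exact: enum_uniq.
have [i0 _] : exists i, i \in t.
  by case: (t) sz_t => // i u _; exists i; rewrite mem_head.
pose s j := nth i0 t j.
have s_col i j : i < j -> j < n.+3 -> col (s i) (s j) = k.
  move=> ij jn; have /pairwiseP := pw_t.
  by move=> /(_ i0 i j) H; apply/eqP/H; rewrite ?inE ?sz_t // (ltn_trans ij).
have far (a b : 'I_n) : a < b -> ~~ dist_le r (v (s a) a) (v (s b) b).
  move=> ab; apply/negP => /hub_dist[h [p [q [w [hd pqr [hx hy] px qy]]]]].
  have pr : p < r.+1 by rewrite ltnS (leq_trans (leq_addr _ _) pqr).
  have qr : q < r.+1 by rewrite ltnS (leq_trans (leq_addl _ _) pqr).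
  pose z : D := (a, b, (Ordinal hd, Ordinal pr, Ordinal qr)).
  have zk : z \in k.
    rewrite -(@s_col a b ab); last by rewrite (ltn_trans (ltn_ord b)) // !ltnS ltnW.
    by rewrite inE; apply/asboolP; exists w.
  have lk i j : i < j -> j < n.+3 -> link h p q (v (s i) a) (v (s j) b).
    by move=> ij jn; move: zk; rewrite -(s_col i j ij jn) inE => /asboolP.
  have [w1 [x1 y1 _ d1]] : link h p q (v (s 0) a) (v (s 1) b) by exact: lk.
  have [w2 [x2 y2 _ _]] : link h p q (v (s 0) a) (v (s 2) b) by exact: lk.
  have [w3 [x3 y3 d3 _]] : link h p q (v (s 1) a) (v (s 2) b) by exact: lk.
  have w12 := hub_fun _ _ _ _ x1 x2; have w23 := hub_fun _ _ _ _ y2 y3.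
  rewrite -w23 -w12 in d3; have dj := dist_le_add d3 d1 pqr.
  have /negP[] := (HI (s 1)).1 _ _ (v_in (s 1) a) (v_in (s 1) b).
  rewrite -[adj _ _]/((_ != _) && dist_le r (v (s 1) a) (v (s 1) b)) dj andbT.
  by apply: contraTneq ab => /v_inj->; rewrite ltnn.
(* Members of the family may overlap; the picks differ because [far] separates them while a vertex
   is close to itself. *)
have u_inj : injective (fun a : 'I_n => v (s a) a).
  move=> a b /= e; apply/val_inj; case: (ltngtP a b) => // /far.
    by rewrite e dist_le_refl.
  by rewrite e dist_le_refl.
exists [set v (s a) a | a : 'I_n]; split; last by rewrite card_imset // card_ord.
split.
  move=> _ _ /imsetP[a _ ->] /imsetP[b _ ->]; rewrite /= negb_and negbK.
  case: (ltngtP a b) => [ab|ba|/val_inj->]; last by rewrite eqxx.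
    by rewrite far ?orbT.
  by rewrite dist_le_sym far ?orbT.
have pre (x : {x : G | x \in [set v (s a) a | a : 'I_n]}) :
    exists a : 'I_n, val x = v (s a) a.
  by case/imsetP: (valP x) => a _; exists a.
have [g Hg] := choice pre.
exists (fun x => s (g x)); split=> [x y /eqP|x]; last by rewrite Hg.
have le3 (a : 'I_n) : a < size t.
  by rewrite sz_t (ltn_trans (ltn_ord a)) // !ltnS ltnW.
rewrite nth_uniq // => /eqP/val_inj e.
by apply: val_inj; rewrite !Hg e.
Qed.

(** * Ancestors and depth in rooted forests *)

(* If two simple paths leave [x] by different edges, their ends are connected
   in the graph minus [x], which closes a cycle through [x]. *)
Lemma acyclic_simple_path_unique (G : sgraph) (x : G) (p q : seq G) :
  acyclic G -> simple_path x p -> simple_path x q -> last x p = last x q -> p = q.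
Proof.
move=> acG; elim: p x q => [|a p IH] x [|b q] //.
- by move=> _ /andP[_ /= /andP[/negP nx _]] /= e; case: nx; rewrite e mem_last.
- by move=> /andP[_ /= /andP[/negP nx _]] _ /= e; case: nx; rewrite -e mem_last.
rewrite /simple_path /= => /andP[/andP[xa pa] /and3P[nxa na ua]].
move=> /andP[/andP[xb pb] /and3P[nxb nb ub]] elast.
have [eab|nab] := eqVneq a b.
  by subst b; congr cons; apply: (IH a); rewrite /simple_path /= ?pa ?pb ?na ?nb.
pose e := [rel u w : G | adj u w && ((u != x) && (w != x))].
have e_sym : connect_sym e.
  apply: sym_connect_sym => u w; rewrite /= adj_sym.
  by rewrite [(u != x) && _]andbC.
have conn c u : x \notin c :: u -> path adj c u -> connect e c (last c u).
  move=> nx pu; apply/connectP; exists u => //.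
  elim: u c nx pu => //= c' u IHu c; rewrite !inE !negb_or.
  move=> /and3P[xc xc' xu] /andP[cc' pu].
  by rewrite cc' (eq_sym c) xc (eq_sym c') xc' /= IHu // inE negb_or xc'.
have : connect e a b.
  apply: connect_trans (conn _ _ nxa pa) _.
  by rewrite elast e_sym; exact: conn.
move=> /connectP[u0 pu0 lu0]; move: nab; rewrite lu0.
case/shortenP: pu0 lu0 => u pu uu _ lu nab.
have pu' : path adj a u by apply: sub_path pu => c c' /= /andP[].
have xu : x \notin a :: u.
  apply/negP; rewrite inE => /orP[/eqP e1|xu].
    by rewrite e1 inE eqxx in nxa.
  case/splitPr: xu pu => u1 u2; rewrite cat_path /= => /and3P[_ /and3P[_ _]].
  by rewrite eqxx.
exfalso; apply: (acG (x :: a :: u)).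
  (* An empty [u] would give [a = b], so the cycle has at least three vertices. *)
  by case: (u) nab => //=; rewrite eqxx.
apply/andP; split; last by rewrite /= xu.
by rewrite /= rcons_path xa pu' -lu adj_sym xb.
Qed.

Section RootedForest.
Variable F : rforest.

Lemma path_to_root_exists (u : F) : exists p, simple_path u p /\ last u p \in Defs.roots F.
Proof.
have [t [[tr /connectP[p pp lp]] _]] := forest_root u.
rewrite lp in tr; case/shortenP: pp tr => q pq uq _ lq.
by exists q; rewrite /simple_path pq uq.
Qed.

(** [size (up u)] serves as the depth of [u], with roots at depth 0. *)
Definition up (u : F) : seq F := projT1 (cid (path_to_root_exists u)).

Lemma up_simple (u : F) : simple_path u (up u).
Proof. by rewrite /up; case: cid => p []. Qed.

Lemma up_root (u : F) : last u (up u) \in Defs.roots F.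
Proof. by rewrite /up; case: cid => p []. Qed.

Lemma up_unique (u : F) p : simple_path u p -> last u p \in Defs.roots F -> p = up u.
Proof.
move=> sp lp; apply: (acyclic_simple_path_unique (@forest_acyclic F) sp (up_simple u)).
have conn q : simple_path u q -> connect adj u (last u q).
  by move=> /andP[pq _]; apply/connectP; exists q.
have [t [_ Ht]] := forest_root u.
rewrite -(Ht (last u p)); last by split=> //; exact: conn.
by apply: Ht; split; [exact: up_root | exact: conn (up_simple u)].
Qed.

Definition ancestors (u : F) : seq F := u :: up u.

Lemma ancestorP (v u : F) : ancestor v u <-> v \in ancestors u.
Proof.
split=> [[p [sp lp vp]]|vu]; last by exists (up u); rewrite up_simple up_root.
by rewrite /ancestors -(up_unique sp lp).
Qed.

(** The rest of [up u] after [v] is a simple path from [v] to a root, so uniqueness makes it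
    [up v]. *)
Lemma ancestors_suffix (u v : F) :
  v \in ancestors u -> exists s, ancestors u = s ++ ancestors v.
Proof.
rewrite /ancestors inE => /orP[/eqP->|vu]; first by exists [::].
have := up_simple u; have := up_root u.
case/splitPr: vu => p1 p2; rewrite last_cat /= => lp.
rewrite /simple_path cat_path -cat_cons cat_uniq /= => /andP[/and3P[_ _ pp] /and3P[_ _ up2]].
exists (u :: p1); rewrite -(@up_unique v p2) //.
by rewrite /simple_path pp.
Qed.

Lemma ancestors_trans (u v w : F) :
  w \in ancestors v -> v \in ancestors u -> w \in ancestors u.
Proof.
by move=> wv /ancestors_suffix[s ->]; rewrite mem_cat wv orbT.
Qed.

Lemma ancestors_size (u v : F) :
  v \in ancestors u -> size (up u) <= size (up v) -> v = u.
Proof.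
move=> /ancestors_suffix[[|x s] E]; first by case: E.
move=> le; have := congr1 size E.
rewrite size_cat /= addnS => -[E'].
by move: le; rewrite E' ltnNge leq_addl.
Qed.

(** Two suffixes of the same list [ancestors u] are nested. *)
Lemma ancestors_chain (u v w : F) : v \in ancestors u -> w \in ancestors u ->
  v \in ancestors w \/ w \in ancestors v.
Proof.
move=> /ancestors_suffix[s Es] /ancestors_suffix[t Et].
move: Es; rewrite Et; elim: s t {Et} => [|a s IH] [|b t] /=.
- by case=> ->; left; rewrite inE eqxx.
- by move=> E; right; rewrite -E -cat_cons mem_cat [w \in ancestors w]mem_head orbT.
- by move=> E; left; rewrite E -cat_cons mem_cat [v \in ancestors v]mem_head orbT.
- by move=> [_ /IH].
Qed.

(** This makes the hub of a vertex at a given depth unique. *)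
Lemma ancestors_depth_inj (u v w : F) : v \in ancestors u -> w \in ancestors u ->
  size (up v) = size (up w) -> v = w.
Proof.
move=> vu wu e; case: (ancestors_chain vu wu) => H.
  by apply: (ancestors_size H); rewrite e.
by apply/esym/(ancestors_size H); rewrite e.
Qed.

Lemma closure_adj_ancestors (x y : F) : closure_adj x y ->
  x \in ancestors y \/ y \in ancestors x.
Proof.
rewrite /closure_adj /= => /andP[_ /orP[xy|/asboolP[]/ancestorP]]; [|by left|by right].
have [yx|nyx] := boolP (y \in ancestors x); first by right.
(* Stepping to [x] and then going up is a simple path from [y] to a root, hence equals [up y]. *)
left; rewrite /ancestors -(@up_unique y (x :: up x)) ?up_root //.
  by rewrite !inE eqxx orbT.
have /andP[px ux] := up_simple x.
by rewrite /simple_path /= adj_sym xy px nyx.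
Qed.

(** Since [height] measures root-to-leaf paths, [v] is replaced by a deepest descendant [w], which
    is a leaf; reversing the path from [w] to its root gives such a path. *)
Lemma depth_lt_height (v : F) : size (up v) < height F.
Proof.
have vv : v \in ancestors v by rewrite inE eqxx.
have [w vw wmax] := arg_maxnP (fun w => size (up w)) (vv : (fun w => v \in ancestors w) v).
have vlew : size (up v) <= size (up w) by exact: wmax.
have lw : leaf w.
  move=> u /ancestorP wu; apply/esym/(ancestors_size wu)/wmax.
  exact: ancestors_trans vw wu.
have /andP[pw uw] := up_simple w.
have szw : (size (up w)).+1 < #|F|.+1.
  by rewrite ltnS -[(size _).+1]/(size (w :: up w)) -(card_uniqP uw) max_card.
apply: (@leq_trans (size (up w)).+1) => //.
rewrite /height.
have -> : (size (up w)).+1 = Ordinal szw by [].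
apply: (@leq_bigmax_cond _ _ (fun k : 'I_#|F|.+1 => k : nat)); apply/asboolP.
exists (last w (up w)), (rev (belast w (up w))); split; last first.
  by rewrite /= size_rev size_belast.
have E : last w (up w) :: rev (belast w (up w)) = rev (w :: up w).
  by rewrite [in RHS]lastI rev_rcons.
split; first exact: up_root.
  rewrite /simple_path rev_path (eq_path (e' := adj)) ?pw; last by move=> a b; rewrite adj_sym.
  by rewrite E rev_uniq.
have -> : last (last w (up w)) (rev (belast w (up w))) = w; last exact: lw.
by case: (up w) => [|a q] //=; rewrite rev_cons last_rcons.
Qed.

End RootedForest.

(** * Walks in graphs of bounded tree-depth *)

(** Induction gives a top [w] for the walk from [y]. If [f x] lies below [f y], it still works;
    otherwise [f x] and [f w] are both above [f y], hence comparable, and the higher one works. *)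
Lemma path_common_ancestor (G : sgraph) (F : rforest) (f : G -> closure_graph F)
    (x : G) (p : seq G) :
  {homo f : x y / adj x y} -> path adj x p ->
  exists2 w, w \in x :: p & forall z, z \in x :: p -> f w \in ancestors (f z).
Proof.
move=> f_adj; elim: p x => [|y p IH] x /=.
  by move=> _; exists x => [|z]; rewrite inE // => /eqP->; rewrite mem_head.
move=> /andP[xy /IH[w wp Hw]].
have wy := Hw y (mem_head _ _).
have use_w : f w \in ancestors (f x) -> exists2 w, w \in x :: y :: p &
    forall z, z \in x :: y :: p -> f w \in ancestors (f z).
  move=> wx; exists w; first by rewrite inE wp orbT.
  by move=> z; rewrite inE => /orP[/eqP->//|/Hw].
case: (closure_adj_ancestors (f_adj _ _ xy)) => [xay|yax]; last first.
  exact: use_w (ancestors_trans wy yax).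
case: (ancestors_chain xay wy) => [xw|]; last exact: use_w.
exists x; first exact: mem_head.
move=> z; rewrite inE => /orP[/eqP->|/Hw wz]; first exact: mem_head.
exact: ancestors_trans xw wz.
Qed.

Lemma treedepth_hub_system (d r : nat) (G : sgraph) : treedepth G <= d ->
  exists hub : nat -> G -> G -> Prop, hub_system d r hub.
Proof.
rewrite /treedepth; case: ex_minnP => k /asboolP[F [[f [f_inj f_adj]] hF]] _ kd.
exists (fun h x w => f w \in ancestors (f x) /\ size (up (f w)) = h); split.
  move=> h x w w' [wx <-] [wx' e].
  by apply/f_inj/(ancestors_depth_inj wx wx').
move=> x y /dist_leP[p [pp szp] lp].
have [w wp Hw] := path_common_ancestor f_adj pp.
have wx := Hw x (mem_head _ _).
have wy : f w \in ancestors (f y) by apply: Hw; rewrite -lp mem_last.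
(* Cutting the walk at [w] yields the two distances, whose sum is at most [r]. *)
case/splitPl: wp pp szp lp => p1 p2 lp1.
rewrite cat_path size_cat last_cat lp1 => /andP[pp1 pp2] szp lp2.
exists (size (up (f w))), (size p1), (size p2), w; split=> //.
- by apply: leq_trans kd; rewrite -hF; exact: depth_lt_height.
- by apply/dist_leP; exists p1.
- by apply/dist_leP; exists p2.
Qed.

Theorem theorem3p1 (R : realType) (d r n : nat)
    (hd : 0 < d) (hr : 0 < r) (hn : 0 < n) :
  (rainbow_num_class R (power_class r (treedepth_class d)) n < +oo)%E.
Proof.
have [K HK] := hub_system_forces_rainbow d r n.
apply: (@Order.POrderTheory.le_lt_trans _ _ ((K%:R)%:E)%E); last exact: ltry.
apply: ge_ereal_sup => _ [H [G Gd ->] ->].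
rewrite lee_fin Num.Theory.ler_nat /rainbow_num; case: ex_minnP => k _; apply.
have [hub Hhub] := treedepth_hub_system r Gd.
by apply/asboolP; exact: HK Hhub.
Qed.
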